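(* Consider a network with $n$ buses, bus admittance matrix $\mathbf{Y}$, and voltage bounds $\underline{V}_i\le\overline{V}_i$ at each bus $i$. Let $$\mathcal{P}=\{\mathbf{p}\in\mathbb{R}^n : \exists\,\mathbf{v}=(V_1,\dots,V_n)\in\mathbb{C}^n,\ \mathbf{p}=\operatorname{Re}(\operatorname{diag}(\mathbf{v}\mathbf{v}^H\mathbf{Y}^H)),\ \underline{V}_i\le|V_i|\le\overline{V}_i\ \forall i\},$$ $$\tilde{\mathcal{P}}=\{\mathbf{p}\in\mathbb{R}^n : \exists\,\mathbf{W}\in\mathbb{C}^{n\times n}\text{ Hermitian},\ \mathbf{p}=\operatorname{Re}(\operatorname{diag}(\mathbf{W}\mathbf{Y}^H)),\ \underline{V}_i^2\le W_{ii}\le\overline{V}_i^2\ \forall i,\ \mathbf{W}\succeq 0\}.$$ If the network is obtained by repeatedly 1-connecting networks each of which is a lossless cycle or a tree, then $\operatorname{convhull}(\mathcal{P})=\tilde{\mathcal{P}}$.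
   Context: A network is a connected undirected simple graph on buses $1,\dots,n$; write $i\sim k$ if buses $i\neq k$ are joined by a line. Each line $i\sim k$ has admittance $y_{ik}=y_{ki}=g_{ik}+jb_{ik}$ ($j=\sqrt{-1}$) with $b_{ik}<0$ (lines are inductive) and $g_{ik}\geq 0$; the line is lossless if $g_{ik}=0$. Each bus $i$ has a shunt admittance to ground $y_{ii}$. The bus admittance matrix $\mathbf{Y}$ is the symmetric matrix with $Y_{ii}=\sum_{l\sim i}y_{il}+y_{ii}$, $Y_{ik}=-y_{ik}$ if $i\sim k$, and $Y_{ik}=0$ if $i\neq k$, $i\nsim k$. A network is lossless if all entries of $\mathbf{Y}$ are purely imaginary. A lossless cycle is a lossless network whose graph is a cycle; a tree is a network whose graph is a tree (its lines need not be lossless). Given two networks $G$ and $H$, a network $K$ is a 1-connection of $G$ and $H$ (is obtained by 1-connecting $G$ and $H$) if $K$ can be decomposed into two components $K_1$ and $K_2$ that have exactly one bus in common and no lines between them otherwise, where $K_1$ is equal to $G$ and $K_2$ is equal to $H$ (equal meaning with identical admittances; in particular a lossless line of $G$ or $H$ is a lossless line of $K$). The voltage bounds satisfy $0\le\underline{V}_i\le\overline{V}_i<\infty$. $(\cdot)^H$ is the conjugate transpose, $\operatorname{diag}(\mathbf{M})$ is the vector of diagonal entries of $\mathbf{M}$, $\mathbf{W}\succeq0$ means positive semidefinite, and $\operatorname{convhull}$ is the convex hull. *)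

(* Defs.v *)
From HB Require Import structures.
From mathcomp Require Import all_boot all_order all_algebra.
From mathcomp Require Import spectral sesquilinear.
From mathcomp Require Import boolp classical_sets reals convex.
From mathcomp Require Import complex.

Set Implicit Arguments.
Unset Strict Implicit.
Unset Printing Implicit Defensive.

Import Order.TTheory GRing.Theory Num.Theory.
Local Open Scope classical_set_scope.
Local Open Scope ring_scope.
Local Open Scope complex_scope.
Local Open Scope sesquilinear_scope.

(* [conductance y = g] and [susceptance y = b] when y = g + j b. *)
Definition conductance (R : realType) (y : R[i]) : R := complex.Re y.
Definition susceptance (R : realType) (y : R[i]) : R := complex.Im y.

(* Buses 1, ..., n are the elements of 'I_n.  [admittance i k] is meaningful
   only when [line i k] holds: its value elsewhere is never used.  The
   admittance to ground y_ii is [shunt i], an arbitrary complex number. *)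
Record network (R : realType) (n : nat) := Network {
  line : rel 'I_n;
  admittance : 'I_n -> 'I_n -> R[i];
  shunt : 'I_n -> R[i];
  network_nonempty : (0 < n)%N;
  line_irreflexive : irreflexive line;
  line_symmetric : symmetric line;
  line_connected : forall i k, connect line i k;
  admittance_sym : forall i k, line i k -> admittance i k = admittance k i;
  susceptance_lt0 : forall i k, line i k -> susceptance (admittance i k) < 0;
  conductance_ge0 : forall i k, line i k -> 0 <= conductance (admittance i k)
}.

Definition bus_admittance (R : realType) (n : nat) (N : network R n) :
    'M[R[i]]_n :=
  \matrix_(i, k)
    if i == k then \sum_(l | line N i l) admittance N i l + shunt N i
    else if line N i k then - admittance N i k
    else 0.

Definition lossless (R : realType) (n : nat) (N : network R n) : Prop :=
  forall i k, complex.Re (bus_admittance N i k) = 0.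

(* The graph is a cycle: its vertices can be listed in cyclic order, without
   repetition, so that the edges are exactly the pairs of cyclically
   consecutive vertices. *)
Definition cycle_graph (T : finType) (e : rel T) : Prop :=
  exists c : seq T,
    [/\ uniq c, (2 < size c)%N, forall x, x \in c
      & forall x y, e x y = (y == next c x) || (x == next c y)].

(* Connected, without a cycle; two vertices joined by an edge form an
   [ucycle] of size 2, hence the bound on the size. *)
Definition tree_graph (T : finType) (e : rel T) : Prop :=
  (forall x y, connect e x y) /\
  (forall c : seq T, (2 < size c)%N -> ~ ucycle e c).

Definition lossless_cycle (R : realType) (n : nat) (N : network R n) : Prop :=
  lossless N /\ cycle_graph (line N).

Definition tree_network (R : realType) (n : nat) (N : network R n) : Prop :=
  tree_graph (line N).

(* The injections f and g name in K the buses of the two components, which are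
   G and H with their own bus numbering; the common bus is f a0 = g b0.  The
   circuit K being decomposed into two components, the admittance to ground at
   the common bus is shared out between them (parallel admittances add up), so
   that the bus admittance matrix of K is the sum of those of G and H. *)
Definition one_connection (R : realType) (n m1 m2 : nat)
    (K : network R n) (G : network R m1) (H : network R m2) : Prop :=
  exists (f : 'I_m1 -> 'I_n) (g : 'I_m2 -> 'I_n) (a0 : 'I_m1) (b0 : 'I_m2),
    (injective f /\ injective g) /\
    (forall k, (exists a, k = f a) \/ (exists b, k = g b)) /\
    (forall a b, f a = g b <-> a = a0 /\ b = b0) /\
    (forall a a', line K (f a) (f a') = line G a a') /\
    (forall b b', line K (g b) (g b') = line H b b') /\
    (forall a b, a != a0 -> b != b0 -> ~~ line K (f a) (g b)) /\
    (forall a a', line G a a' ->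
       admittance K (f a) (f a') = admittance G a a') /\
    (forall b b', line H b b' ->
       admittance K (g b) (g b') = admittance H b b') /\
    (forall a, a != a0 -> shunt K (f a) = shunt G a) /\
    (forall b, b != b0 -> shunt K (g b) = shunt H b) /\
    shunt K (f a0) = shunt G a0 + shunt H b0.

Inductive one_connected_cycles_trees (R : realType) :
    forall n : nat, network R n -> Prop :=
| of_lossless_cycle (n : nat) (N : network R n) :
    lossless_cycle N -> one_connected_cycles_trees N
| of_tree (n : nat) (N : network R n) :
    tree_network N -> one_connected_cycles_trees N
| of_one_connection (n m1 m2 : nat)
    (K : network R n) (G : network R m1) (H : network R m2) :
    one_connected_cycles_trees G -> one_connected_cycles_trees H ->
    one_connection K G H -> one_connected_cycles_trees K.

(* [M ^t*] is the conjugate transpose; in R[i], 0 <= z means that z is real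
   and nonnegative. *)
Definition psdmx (R : realType) (n : nat) (W : 'M[R[i]]_n) : Prop :=
  forall x : 'cV[R[i]]_n, 0 <= (x ^t* *m W *m x) 0 0.

Definition Re_diag (R : realType) (n : nat) (M : 'M[R[i]]_n) : 'cV[R]_n :=
  \col_i complex.Re (M i i).

Definition injection_region (R : realType) (n : nat) (Y : 'M[R[i]]_n)
    (Vmin Vmax : 'I_n -> R) : set 'cV[R]_n :=
  [set p | exists v : 'cV[R[i]]_n,
     p = Re_diag (v *m v ^t* *m Y ^t*) /\
     forall i, (Vmin i)%:C <= `|v i 0| <= (Vmax i)%:C].

Definition relaxed_injection_region (R : realType) (n : nat)
    (Y : 'M[R[i]]_n) (Vmin Vmax : 'I_n -> R) : set 'cV[R]_n :=
  [set p | exists W : 'M[R[i]]_n,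
     [/\ W \is hermsymmx,
         p = Re_diag (W *m Y ^t*),
         forall i, (Vmin i ^+ 2)%:C <= W i i <= (Vmax i ^+ 2)%:C
       & psdmx W]].

Definition convhull (R : realType) (n : nat) (A : set 'cV[R]_n) :
    set 'cV[R]_n :=
  smallest (@convex_set R 'cV[R]_n) A.

(* Main.v *)
(* Fix W in the relaxation. Its injections only involve its diagonal and its
   entries at the lines, and these turn out to be, on every such network, a
   convex combination of those of matrices v v^H with |V_i|^2 = W_ii. On a
   tree, each line entry lies in the disc of radius |V_i| |V_k|, hence
   between two points of its circle, and phase differences can be prescribed
   line by line. At a 1-connection the two convex combinations are taken
   independently, with the phases aligned at the common bus.

   On a cycle (lossless or not), scale W to unit diagonal and let u_k be its
   entries along the cycle. Positive semidefiniteness gives, for all phases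
   alpha_k with sum pi, that the angles arccos Re(u_k e^(i alpha_k)) add up
   to at least pi. If some sum equals pi and all |u_k| < 1, alpha minimises
   the sum, and the first order conditions exhibit u as a combination of two
   points e^(i theta) with sum of the theta_k in 2 pi Z. Otherwise move one
   u_k along a chord until this occurs at both ends, or until |u_k| = 1 and
   the line can be contracted. *)
Require Import Defs.
From mathcomp Require Import all_boot all_order all_algebra.
From mathcomp Require Import spectral sesquilinear.
From mathcomp Require Import boolp classical_sets reals convex.
From mathcomp Require Import interval_inference.
From mathcomp Require Import topology normedtype derive realfun trigo.
From mathcomp Require Import complex.
From mathcomp Require Import ring lra.

Set Implicit Arguments.
Unset Strict Implicit.
Unset Printing Implicit Defensive.

Import Order.TTheory GRing.Theory Num.Theory.
Import numFieldNormedType.Exports.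
Local Open Scope classical_set_scope.
Local Open Scope ring_scope.
Local Open Scope complex_scope.

(** * Convex combinations in complex vector spaces *)

(** An inductive form of the convex hull, so that matrices can be built along the derivation of a
    mixture. *)
Inductive mixture (R : realType) (V : lmodType R[i]) (S : set V) : set V :=
| mixture_in x : S x -> mixture S x
| mixture_conv (t : R) x y : 0 <= t <= 1 -> mixture S x -> mixture S y ->
    mixture S (t%:C *: x + (1 - t)%:C *: y).

Lemma mixture_map (R : realType) (V W : lmodType R[i]) (S : set V) (S' : set W)
    (f : V -> W) x :
  (forall (t : R) y z,
     f (t%:C *: y + (1 - t)%:C *: z) = t%:C *: f y + (1 - t)%:C *: f z) ->
  (forall y, S y -> S' (f y)) -> mixture S x -> mixture S' (f x).
Proof.
move=> aff SS'; elim=> {x} [x /SS'|t x y t01 _ IHx _ IHy].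
  exact: mixture_in.
by rewrite aff; apply: mixture_conv.
Qed.

(** * Angles of rotated points of the unit disc *)

Section angles.
Context {R : realType}.
Implicit Types (a b x y t : R) (u : R[i]).

Definition cis x : R[i] := cos x +i* sin x.

Definition clamp x : R := Num.max (-1) (Num.min 1 x).

Lemma clamp_itv x : -1 <= clamp x <= 1.
Proof. by rewrite /clamp le_max lexx/= ge_max ge_min lexx/= andbT; lra. Qed.

Lemma clamp_id x : -1 <= x <= 1 -> clamp x = x.
Proof. by move=> /andP[? ?]; rewrite /clamp min_r// max_r. Qed.

Lemma continuous_clamp : continuous clamp.
Proof.
move=> x; apply: (@continuous_max _ _ (fun=> -1) (fun x => Num.min 1 x)).
  exact: cvg_cst.
apply: (@continuous_min _ _ (fun=> 1) id); first exact: cvg_cst.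
exact: cvg_id.
Qed.

(** On [-1, 1] [acos] is the inverse of the continuous [cos] on [0, pi], and [clamp] maps
    continuously into [-1, 1]. *)
Lemma acos_clamp_continuous : continuous (fun x => acos (clamp x)).
Proof.
have acosC : {within `[-1, 1 : R], continuous acos}.
  rewrite -(@cospi R) -(@cos0 R); apply: segment_can_ge_continuous.
  - exact: pi_ge0.
  - by apply: continuous_subspaceT => x; exact: continuous_cos.
  - exact: cosK.
move=> x; have /= cx := clamp_itv x.
have /= H := (subspace_continuousP _ _).1 acosC (clamp x) cx.
apply: (@cvg_comp _ _ _ clamp acos (nbhs x)
  (within `[-1, 1] (nbhs (clamp x))) (nbhs (acos (clamp x))) _ H).
move=> B /= /(continuous_clamp (x := x)) /= xB.
apply: (@filterS _ (nbhs x) _ _ _ _ xB) => y /=; apply.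
by rewrite in_itv; exact: clamp_itv.
Qed.

Lemma cis_addpi2 x (m : nat) : cis (x + pi *+ 2 *+ m) = cis x.
Proof.
by rewrite /cis (periodicn (@cosD2pi R)) (periodicn (@sinD2pi R)).
Qed.

Lemma cos_addpi2 x (m : nat) : cos (x + pi *+ 2 *+ m) = cos x.
Proof. by rewrite (periodicn (@cosD2pi R)). Qed.

(** A natural multiple of 2 pi on each side replaces a signed one, so that periodicity is only used
    for natural numbers. *)
Lemma angle_reduction x : exists2 y, 0 <= y <= pi *+ 2 &
  exists m k : nat, y + pi *+ 2 *+ m = x + pi *+ 2 *+ k.
Proof.
have p0 : 0 < pi *+ 2 :> R by rewrite pmulrn_lgt0// pi_gt0.
move: (pi *+ 2) p0 => p p0.
pose z := Num.floor (x / p).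
exists (x - p *~ z).
  have /andP[] := floor_itv (x / p).
  rewrite -/z ler_pdivlMr// ltr_pdivrMr// intrD mulrDl mul1r -[p *~ z]mulrzl.
  by set q := _ * p => *; apply/andP; split; lra.
case: z => m.
  by exists m, 0%N; rewrite mulr0n addr0 -pmulrn subrK.
by exists 0%N, m.+1; rewrite NegzE mulrNz opprK mulr0n addr0 -pmulrn.
Qed.

Definition sqn u : R := complex.Re u ^+ 2 + complex.Im u ^+ 2.

(* The angle, in [0, pi], whose cosine is the real part of u e^(ix); clamping
   makes it continuous in u and x everywhere and is void when |u| <= 1. *)
Definition ang u x : R :=
  acos (clamp (complex.Re u * cos x - complex.Im u * sin x)).

(* The derivative of [ang u]: the imaginary part of u e^(ix) divided by the sine
   of its angle. *)
Definition slope u x : R :=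
  (complex.Re u * sin x + complex.Im u * cos x) / sin (ang u x).

Lemma sqn_rot u x : (complex.Re u * cos x - complex.Im u * sin x) ^+ 2 +
  (complex.Re u * sin x + complex.Im u * cos x) ^+ 2 = sqn u.
Proof. by rewrite -[RHS]mulr1 -(cos2Dsin2 x) /sqn; ring. Qed.

Lemma rot_itv u x : sqn u <= 1 ->
  -1 <= complex.Re u * cos x - complex.Im u * sin x <= 1.
Proof.
move=> u1; rewrite -ler_norml -(@ler_pXn2r _ 2)// ?nnegrE// expr1n.
rewrite real_normK ?num_real//.
by rewrite (le_trans _ u1)// -(sqn_rot u x) lerDl sqr_ge0.
Qed.

Lemma rot_itvoo u x : sqn u < 1 ->
  -1 < complex.Re u * cos x - complex.Im u * sin x < 1.
Proof.
move=> u1; rewrite -ltr_norml -(@ltr_pXn2r _ 2)// ?nnegrE// expr1n.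
rewrite real_normK ?num_real//.
by rewrite (le_lt_trans _ u1)// -(sqn_rot u x) lerDl sqr_ge0.
Qed.

Lemma cos_ang u x : sqn u <= 1 ->
  cos (ang u x) = complex.Re u * cos x - complex.Im u * sin x.
Proof. by move=> u1; rewrite acosK ?clamp_id// ?in_itv/= rot_itv. Qed.

Lemma ang_lepi u x : ang u x <= pi.
Proof. exact/acos_lepi/clamp_itv. Qed.

Lemma sin_ang_gt0 u x : sqn u < 1 -> 0 < sin (ang u x).
Proof.
move=> u1; rewrite /ang clamp_id ?rot_itv ?ltW//.
have /andP[gtN1 lt1] := rot_itvoo x u1; apply: sin_gt0_pi; apply/andP; split.
  by apply: acos_gt0; rewrite lt1 ltW.
by apply: acos_ltpi; rewrite gtN1 ltW.
Qed.

(** The squares of the numerator and of the cosine of the angle add up to |u|^2 < 1, so the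
    numerator is at most the sine in modulus. *)
Lemma slope_itv u x : sqn u < 1 -> -1 <= slope u x <= 1.
Proof.
move=> u1; have s0 := sin_ang_gt0 x u1.
rewrite -ler_norml /slope normrM normfV [`|sin _|]gtr0_norm//.
rewrite ler_pdivrMr// mul1r.
rewrite -(@ler_pXn2r _ 2)// ?nnegrE ?ltW// real_normK ?num_real//.
have := cos2Dsin2 (ang u x); rewrite cos_ang ?ltW//.
by have := sqn_rot u x; lra.
Qed.

Lemma is_derive_ang u x : sqn u < 1 -> is_derive x 1 (ang u) (slope u x).
Proof.
move=> u1; have [ltN1 lt1] := andP (rot_itvoo x u1).
have -> : ang u =
    acos \o (fun y => complex.Re u * cos y - complex.Im u * sin y).
  by apply/funext => y; rewrite /ang clamp_id// rot_itv// ltW.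
have rotD : is_derive x 1 (fun y => complex.Re u * cos y - complex.Im u * sin y)
    (- (complex.Re u * sin x + complex.Im u * cos x)).
  apply: is_derive_eq.
  rewrite /GRing.scale/=.
  by ring.
have acosD := is_derive1_acos (rot_itvoo x u1).
apply: (is_derive_eq
  (is_derive1_comp (f := acos) (g := fun y => _ - _) acosD rotD)).
rewrite /GRing.scale/= /slope /ang clamp_id ?rot_itv ?ltW//.
rewrite sin_acos ?rot_itv ?ltW//.
by ring.
Qed.

(** First order condition for passing phase from one point to the other: at e = 0 the derivative is
    the difference of the slopes. *)
Lemma slope_eq u1 u2 x1 x2 : sqn u1 < 1 -> sqn u2 < 1 ->
  (forall e, ang u1 x1 + ang u2 x2 <= ang u1 (x1 + e) + ang u2 (x2 - e)) ->
  slope u1 x1 = slope u2 x2.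
Proof.
move=> u11 u21 min12.
pose f (e : R) := ang u1 (x1 + e) + ang u2 (x2 - e).
have fD (e : R) : is_derive e 1 f (slope u1 (x1 + e) - slope u2 (x2 - e)).
  have D1 := is_derive_ang (x1 + e) u11.
  have D2 := is_derive_ang (x2 - e) u21.
  have E1 : is_derive e 1 (fun e => x1 + e) 1 by apply: is_derive_eq; ring.
  have E2 : is_derive e 1 (fun e => x2 - e) (-1) by apply: is_derive_eq; ring.
  have F1 := is_derive1_comp (f := ang u1) (g := fun e => x1 + e) D1 E1.
  have F2 := is_derive1_comp (f := ang u2) (g := fun e => x2 - e) D2 E2.
  by apply: (is_derive_eq (is_deriveD F1 F2)); rewrite /GRing.scale/=; ring.
have f0 : is_derive (0 : R) 1 f 0.
  apply: (@derive1_at_min _ f (-1) 1 0); rewrite ?in_itv/=; [lra| |lra|].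
    by move=> t _; have [] := fD t.
  by move=> t _; rewrite /f addr0 subr0.
have := fD 0; rewrite addr0 subr0 => /@derive_val E.
by apply/eqP; rewrite -subr_eq0 -E; have /@derive_val -> := f0.
Qed.

End angles.

(** * Points of a product of discs as mixtures of torus points *)

Section torus.
Context {R : realType} {n : nat}.
Implicit Types (A : {set 'I_n}) (tau : R) (u : 'rV[R[i]]_n) (alpha : 'rV[R]_n).

Definition angsum A u alpha : R := \sum_(i in A) ang (u 0 i) (alpha 0 i).

(* [closing] is the spherical triangle inequality: if the u_i are the inner
   products of consecutive unit vectors around a cycle, then turning them by
   phases that add up to pi leads from a vector to its opposite, so the total
   angle travelled is at least pi.  The phase [tau] accounts for the edges of
   the cycle that were contracted, on which u_i has modulus 1. *)
Definition closing A tau u := forall alpha,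
  cos (\sum_(i in A) alpha 0 i + tau) = -1 -> pi <= angsum A u alpha.

(** The sum of [theta] is [tau] modulo 2 pi. The sign of [tau] is opposite to that in [closing],
    where the phases turn [u] instead of being its arguments. Coordinates outside [A] are free, so
    contracted edges stay in the vector. *)
Definition torus A tau : set 'rV[R[i]]_n := [set z | exists2 theta : 'rV[R]_n,
  cos (\sum_(i in A) theta 0 i - tau) = 1 &
  forall i, i \in A -> z 0 i = cis (theta 0 i)].

(** By [closing], [alpha] minimises the total angle; passing phase from k to i keeps the sum of the
    phases, so [slope_eq] applies. *)
Lemma closing_min_slope A tau u alpha i k :
  closing A tau u -> (forall j, j \in A -> sqn (u 0 j) < 1) ->
  cos (\sum_(j in A) alpha 0 j + tau) = -1 -> angsum A u alpha <= pi ->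
  i \in A -> k \in A ->
  slope (u 0 i) (alpha 0 i) = slope (u 0 k) (alpha 0 k).
Proof.
move=> cl u1 alphaE le_pi iA kA; have [->//|ik] := eqVneq i k.
apply: slope_eq => [||e]; [exact: u1|exact: u1|].
pose beta : 'rV[R]_n := \row_j
  if j == i then alpha 0 j + e else if j == k then alpha 0 j - e else alpha 0 j.
have betaE j : j != i -> j != k -> beta 0 j = alpha 0 j.
  by move=> /negPf ji /negPf jk; rewrite mxE ji jk.
have betai : beta 0 i = alpha 0 i + e by rewrite mxE eqxx.
have betak : beta 0 k = alpha 0 k - e by rewrite mxE eqxx eq_sym (negPf ik).
have sum_off (F G : 'I_n -> R) :
    (forall j, j != i -> j != k -> F j = G j) ->
    \sum_(j in A) F j = \sum_(j in A) G j + (F i - G i) + (F k - G k).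
  move=> FG; have kA' : (k \in A) && (k != i) by rewrite kA eq_sym.
  rewrite (bigD1 i iA) (bigD1 k kA')/= (bigD1 i iA (F := G)) (bigD1 k kA')/=.
  rewrite (eq_bigr G) => [|j /andP[/andP[_ ji] jk]]; last exact: FG.
  by ring.
have := cl beta; rewrite /angsum (sum_off _ (fun j => alpha 0 j) betaE).
rewrite (sum_off (fun j => ang (u 0 j) (beta 0 j))
  (fun j => ang (u 0 j) (alpha 0 j))) => [|j ji jk]; last first.
  by rewrite betaE.
rewrite betai betak; move: le_pi; rewrite /angsum => le_pi.
rewrite (_ : _ + _ + _ + tau = \sum_(j in A) alpha 0 j + tau); last by ring.
by move=> /(_ alphaE) => ?; lra.
Qed.

(* At a minimiser alpha of the total angle all the slopes take one value lam, so
   u_i e^(i alpha_i) = cos phi_i + lam i sin phi_i is the same mixture of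
   e^(i phi_i) and e^(- i phi_i) for every i; and the phi_i add up to pi. *)
Lemma closing_boundary A tau u alpha :
  closing A tau u -> (forall j, j \in A -> sqn (u 0 j) < 1) ->
  cos (\sum_(j in A) alpha 0 j + tau) = -1 -> angsum A u alpha <= pi ->
  mixture (torus A tau) u.
Proof.
move=> cl u1 alphaE le_pi.
have sumE : angsum A u alpha = pi by apply/eqP; rewrite eq_le le_pi cl.
have [i0 i0A] : exists i0, i0 \in A.
  apply/set0Pn/eqP => A0; move: sumE; rewrite /angsum A0 big_set0 => /eqP.
  by rewrite lt_eqF ?pi_gt0.
pose lam := slope (u 0 i0) (alpha 0 i0).
have /andP[lamN1 lam1] : -1 <= lam <= 1 by rewrite slope_itv ?u1.
pose th (e : R) : 'rV[R]_n :=
  \row_j (e * ang (u 0 j) (alpha 0 j) - alpha 0 j).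
pose z e : 'rV[R[i]]_n := \row_j if j \in A then cis (th e 0 j) else u 0 j.
have sumth e : \sum_(j in A) th e 0 j = e * pi - \sum_(j in A) alpha 0 j.
  by under eq_bigr do rewrite mxE; rewrite sumrB -mulr_sumr -sumE.
have zP e : cos (e * pi) = -1 -> sin (e * pi) = 0 -> torus A tau (z e).
  move=> ce se; exists (th e); last by move=> i iA; rewrite mxE iA.
  rewrite sumth -addrA -opprD cosB ce se alphaE; ring.
(* The two weights have sum 1 and difference [lam]. *)
have -> : u = ((1 + lam) / 2)%:C *: z 1 + (1 - (1 + lam) / 2)%:C *: z (-1).
  apply/rowP => j; rewrite !mxE.
  case: ifPn => [jA|_]; last first.
    by rewrite -mulrDl -rmorphD/= subrKC mul1r.
  have slopeE : slope (u 0 j) (alpha 0 j) = lam.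
    exact: closing_min_slope cl u1 alphaE le_pi jA i0A.
  have s0 : sin (ang (u 0 j) (alpha 0 j)) != 0.
    by rewrite gt_eqF ?sin_ang_gt0 ?u1.
  have cE := cos_ang (alpha 0 j) (ltW (u1 _ jA)).
  have /(canRL (mulfVK s0)) sE := slopeE.
  have c1 := cos2Dsin2 (alpha 0 j).
  rewrite mul1r mulN1r /cis -opprD cosN sinN cosB sinB cosD sinD.
  move: cE sE; set phi := ang _ _; case: (u 0 j) => a b /= cE sE.
  apply/eqP; rewrite eq_complex/= !mul0r !subr0 !addr0.
  set p := cos phi in cE *; set q := sin phi in sE *.
  set c := cos _ in cE sE c1 *; set s := sin _ in cE sE c1 *.
  (* Undo the rotation by [alpha 0 j], whose two components are [cE] and [sE]. *)
  have -> : a = p * c + lam * q * s.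
    by rewrite cE -sE -[LHS]mulr1 -c1; ring.
  have -> : b = - p * s + lam * q * c.
    by rewrite cE -sE -[LHS]mulr1 -c1; ring.
  by apply/andP; split; apply/eqP; field.
apply: mixture_conv; first by apply/andP; split; lra.
  by apply/mixture_in/zP; rewrite mul1r ?cospi ?sinpi.
by apply/mixture_in/zP; rewrite mulN1r ?cosN ?sinN ?cospi ?sinpi ?oppr0.
Qed.

Definition shift_coord u k (t : R) : 'rV[R[i]]_n :=
  \row_j if j == k then u 0 j + t%:C else u 0 j.

(** Joint continuity closes the set [K] of [closing_push] and lets its minimal t be approached from
    below. *)
Lemma angsum_shift_continuous A u k (s : R) : continuous
  (fun p : R * 'rV[R]_n => angsum A (shift_coord u k (s * p.1)) p.2).
Proof.
rewrite /angsum; apply: continuous_big => [|i _]; first exact: add_continuous.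
rewrite (_ : (fun _ => _) = (fun x => acos (clamp x)) \o
  (fun p : R * 'rV[R]_n =>
    (complex.Re (u 0 i) + (i == k)%:R * s * p.1) * cos (p.2 0 i)
    - complex.Im (u 0 i) * sin (p.2 0 i))); last first.
  apply/funext => p; rewrite /= /ang mxE.
  case: eqP => _; rewrite /= ?mul0r ?mul1r ?addr0//.
  by case: (u 0 i) => a b /=; rewrite addr0.
move=> p; apply: continuous_comp; last exact: acos_clamp_continuous.
have c2 : {for p, continuous (fun p : R * 'rV[R]_n => p.2 0 i)}.
  apply: (@continuous_comp _ _ _ snd (fun v : 'rV[R]_n => v 0 i)).
    exact: cvg_snd.
  exact: coord_continuous.
have c1 : {for p, continuous (fun p : R * 'rV[R]_n => p.1)} by exact: cvg_fst.
apply: cvgB; apply: cvgM.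
- by apply: cvgD; [exact: cvg_cst|apply: cvgM; [exact: cvg_cst|exact: c1]].
- by apply: (continuous_comp c2); exact: continuous_cos.
- exact: cvg_cst.
- by apply: (continuous_comp c2); exact: continuous_sin.
Qed.

(** Phases only matter modulo 2 pi; the box provides the compactness. *)
Lemma closing_box A tau u :
  (forall alpha, (forall i, 0 <= alpha 0 i <= pi *+ 2) ->
    cos (\sum_(i in A) alpha 0 i + tau) = -1 -> pi <= angsum A u alpha) ->
  closing A tau u.
Proof.
move=> H alpha alphaE.
have [b b02 /fin_all_exists[m /fin_all_exists[k bE]]] :=
  fin_all_exists2 (fun i => angle_reduction (alpha 0 i)).
pose beta : 'rV[R]_n := \row_i b i.
have angE i : ang (u 0 i) (beta 0 i) = ang (u 0 i) (alpha 0 i).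
  have /(congr1 cis) := bE i; rewrite !cis_addpi2 mxE => -[ce se].
  by rewrite /ang ce se.
rewrite /angsum -(eq_bigr _ (fun i _ => angE i)); apply: H => [i|].
  by rewrite mxE.
rewrite -alphaE -(cos_addpi2 _ (\sum_(i in A) m i)).
rewrite -[RHS](cos_addpi2 _ (\sum_(i in A) k i)) -!sumrMnr.
rewrite addrAC -big_split [in RHS]addrAC -big_split /=.
by congr (cos (_ + _)); apply: eq_bigr => i _; rewrite mxE.
Qed.

(* The first t at which some total angle comes down to pi: it minimises t over
   the compact set K of the pairs (t, alpha) with total angle at most pi. *)
Lemma closing_push A tau u k (s : R) :
  s ^+ 2 = 1 -> k \in A -> (forall j, j \in A -> sqn (u 0 j) < 1) ->
  closing A tau u ->
  exists2 t, 0 <= t & closing A tau (shift_coord u k (s * t)) /\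
   (sqn (shift_coord u k (s * t) 0 k) = 1 \/
    sqn (shift_coord u k (s * t) 0 k) < 1 /\
    exists2 alpha : 'rV[R]_n, cos (\sum_(j in A) alpha 0 j + tau) = -1
      & angsum A (shift_coord u k (s * t)) alpha <= pi).
Proof.
move=> s2 kA u1 cl.
pose U t := shift_coord u k (s * t).
have UkE t : sqn (U t 0 k) =
    (s * complex.Re (u 0 k) + t) ^+ 2 + complex.Im (u 0 k) ^+ 2.
  rewrite /sqn mxE eqxx; case: (u 0 k) => a b /=; rewrite addr0; congr (_ + _).
  apply/eqP; rewrite -subr_eq0.
  rewrite (_ : _ - _ = (s ^+ 2 - 1) * (t ^+ 2 - a ^+ 2)); last by ring.
  by rewrite s2 subrr mul0r.
(* [r] is half the horizontal chord of the unit circle through [u 0 k], and [T] the time at which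
   the moving coordinate reaches the circle. *)
pose r : R := Num.sqrt (1 - complex.Im (u 0 k) ^+ 2).
pose T := r - s * complex.Re (u 0 k).
have := u1 _ kA; rewrite /sqn => uk1.
have r2 : r ^+ 2 = 1 - complex.Im (u 0 k) ^+ 2.
  rewrite sqr_sqrtr// subr_ge0.
  by rewrite (le_trans _ (ltW uk1))// lerDr sqr_ge0.
have r0 : 0 <= r by exact: sqrtr_ge0.
have sRe : (s * complex.Re (u 0 k)) ^+ 2 = complex.Re (u 0 k) ^+ 2.
  by rewrite exprMn s2 mul1r.
have lt_r : `|s * complex.Re (u 0 k)| < r.
  rewrite -(@ltr_pXn2r _ 2)// ?nnegrE// real_normK ?num_real// sRe r2; lra.
have T0 : 0 <= T by rewrite subr_ge0 (le_trans (ler_norm _))// ltW.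
have UT : sqn (U T 0 k) = 1 by rewrite UkE /T subrKC r2; ring.
have Ult t : 0 <= t < T -> sqn (U t 0 k) < 1.
  rewrite UkE /T => /andP[t0 tT].
  have : (s * complex.Re (u 0 k) + t) ^+ 2 < r ^+ 2.
    rewrite -(real_normK (num_real (_ + t))) ltr_pXn2r ?nnegrE// ltr_norml.
    by move: lt_r; rewrite ltr_norml => /andP[? ?]; apply/andP; split; lra.
  by rewrite r2; lra.
pose P (p : R * 'rV[R]_n) :=
  cos (\sum_(j in A) p.2 0 j + tau) = -1 /\ angsum A (U p.1) p.2 <= pi.
pose box : set (R * 'rV[R]_n) := `[0, T]%classic `*`
  [set v : 'rV[R]_n | forall i, `[0, pi *+ 2]%classic (v ord0 i)].
pose K := box `&` [set p | P p].
have cK : compact K.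
  apply: compact_closedI.
    apply: compact_setX; first exact: segment_compact.
    have := @rV_compact R n (fun=> `[0, pi *+ 2]%classic).
    by apply=> _; exact: segment_compact.
  apply: closedI.
    pose f (p : R * 'rV[R]_n) := cos (\sum_(j in A) p.2 0 j + tau).
    apply: (@preimage_closed _ _ f [set -1]); last exact: closed_eq.
    move=> p _; apply: (@continuous_comp _ _ _
      (fun p : R * 'rV[R]_n => \sum_(j in A) p.2 0 j + tau) cos);
      last exact: continuous_cos.
    apply: cvgD; last exact: cvg_cst.
    have sumC : continuous (fun q : R * 'rV[R]_n => \sum_(j in A) q.2 0 j).
      apply: continuous_big => [|i _]; first exact: add_continuous.
      move=> q; apply: (@continuous_comp _ _ _ snd (fun v : 'rV[R]_n => v 0 i)).
        exact: cvg_snd.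
      exact: coord_continuous.
    exact: sumC.
  pose g (p : R * 'rV[R]_n) := angsum A (U p.1) p.2.
  apply: (@preimage_closed _ _ g [set x | x <= pi]); last exact: closed_le.
  by move=> p _; exact: angsum_shift_continuous.
(* If [K] is empty, the total angle stays above pi up to time [T], when the coordinate is on the
   circle. *)
have [K0|/set0P/negP/negPn/eqP K0] := pselect (K !=set0); last first.
  exists T => //; split; last by left.
  apply: closing_box => alpha a0 aE; rewrite leNgt; apply/negP => /ltW lepi.
  have : K (T, alpha) by split; split => //=; rewrite in_itv/= lexx T0.
  by rewrite K0.
have [|[t al] /set_mem[[/= tT _] [/= alE alpi]] tmin] :=
  @compact_EVT_min _ _ (fst : R * 'rV[R]_n -> R) K K0 cK.
  by apply: continuous_subspaceT => x; exact: cvg_fst.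
exists t; first by move: tT; rewrite in_itv/= => /andP[].
split; last first.
  move: tT; rewrite in_itv/= => /andP[t0]; rewrite le_eqVlt => /predU1P[->|tT].
    by left.
  by right; split; [rewrite Ult ?t0|exists al].
(* At t = 0 this contradicts the hypothesis on [u]; at t > 0 the total angle at [beta] would be
   below pi slightly earlier, against minimality. *)
apply: closing_box => beta b0 bE; rewrite leNgt; apply/negP => ltpi.
have t0 : 0 <= t by move: tT; rewrite in_itv/= => /andP[].
have [t_eq0|t_gt0] : t = 0 \/ 0 < t.
  by move: t0; rewrite le_eqVlt => /predU1P[|]; auto.
  move: ltpi; rewrite ltNge => /negP; apply; rewrite t_eq0 mulr0.
  have -> : shift_coord u k 0 = u by apply/rowP => j; rewrite mxE addr0 if_same.
  exact: cl.
have gC : angsum A (U t') beta @[t' --> t^'-] --> angsum A (U t) beta.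
  apply: cvg_at_left_filter.
  apply: (@continuous_comp _ _ _ (fun t' => (t', beta))
    (fun p : R * 'rV[R]_n => angsum A (U p.1) p.2)).
    have idC : x @[x --> t] --> t by exact: cvg_id.
    have cstC : (fun=> beta) x @[x --> t] --> beta by exact: cvg_cst.
    exact: (cvg_pair idC cstC).
  exact: angsum_shift_continuous.
near t^'- => t'.
have t'_lt : t' < t by near: t'; exact: nbhs_left_lt.
have : t <= t'; last by rewrite leNgt t'_lt.
apply: (tmin (t', beta)); apply/mem_set; split; split => //=.
  rewrite in_itv/=; apply/andP; split.
    by near: t'; exact: nbhs_left_ge.
  by rewrite (le_trans (ltW t'_lt))//; move: tT; rewrite in_itv => /andP[].
by apply: ltW; near: t'; exact: (cvgr_lt (angsum A (U t) beta)).
Unshelve. all: by end_near. Qed.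

Lemma sqrD_le0 (x y : R) : x ^+ 2 + y ^+ 2 <= 0 -> x = 0.
Proof.
move=> xy; apply/eqP; rewrite -sqrf_eq0 eq_le sqr_ge0 andbT.
by rewrite (le_trans _ xy)// lerDl sqr_ge0.
Qed.

Lemma polar (z : R[i]) : sqn z = 1 -> exists x, z = cis x.
Proof.
case: z => a b; rewrite /sqn/= => ab1.
have a1 : -1 <= a <= 1 by apply/andP; split; nra.
have sE : sin (acos a) = `|b|.
  by rewrite sin_acos// -sqrtr_sqr; congr Num.sqrt; lra.
have [b0|b0] := leP 0 b.
  by exists (acos a); rewrite /cis acosK ?in_itv// sE ger0_norm.
exists (- acos a); rewrite /cis cosN sinN acosK ?in_itv// sE ltr0_norm//.
by rewrite opprK.
Qed.

Lemma ang_cis (x : R) : ang (cis x) (- x) = 0.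
Proof.
rewrite /ang/= cosN sinN mulrN opprK -!expr2 cos2Dsin2 clamp_id ?acos1//; lra.
Qed.

(** Turning [u 0 k] by [- x] makes its angle 0, so the other edges carry the whole sum, with the
    phase [- x] moved into [tau]. *)
Lemma closing_contract A tau u k (x : R) : k \in A -> u 0 k = cis x ->
  closing A tau u -> closing (A :\ k) (tau - x) u.
Proof.
move=> kA ukE cl alpha aE.
pose beta : 'rV[R]_n := \row_j if j == k then - x else alpha 0 j.
have bk : beta 0 k = - x by rewrite mxE eqxx.
have bE j : j \in A :\ k -> beta 0 j = alpha 0 j.
  by rewrite !inE mxE => /andP[/negPf->].
have sumE : \sum_(j in A) beta 0 j = - x + \sum_(j in A :\ k) alpha 0 j.
  by rewrite (big_setD1 k)//= bk; congr (_ + _); apply: eq_bigr => j /bE.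
have angE : angsum A u beta = angsum (A :\ k) u alpha.
  rewrite /angsum (big_setD1 k)//= bk ukE ang_cis add0r.
  by apply: eq_bigr => j /bE ->.
by rewrite -angE; apply: cl; rewrite -aE sumE; congr cos; ring.
Qed.

(** Coordinate k is free in the smaller torus and can be reset to [u 0 k] in every term of the
    mixture. *)
Lemma torus_expand A tau u k (x : R) : k \in A -> u 0 k = cis x ->
  mixture (torus (A :\ k) (tau - x)) u -> mixture (torus A tau) u.
Proof.
move=> kA ukE mu.
pose f (z : 'rV[R[i]]_n) : 'rV[R[i]]_n :=
  \row_j if j == k then u 0 k else z 0 j.
have -> : u = f u by apply/rowP => j; rewrite mxE; case: eqP => // ->.
apply: mixture_map mu => [t y z|y [theta thE yE]].
  apply/rowP => j; rewrite !mxE; case: eqP => // _.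
  by rewrite -mulrDl -rmorphD/= subrKC mul1r.
exists (\row_j if j == k then x else theta 0 j) => [|j jA]; last first.
  rewrite !mxE; case: eqP => // /eqP jk.
  by rewrite yE// !inE jk.
rewrite (big_setD1 k)//= mxE eqxx -thE; congr cos.
rewrite (eq_bigr (fun j => theta 0 j)) => [|j]; last first.
  by rewrite !inE mxE => /andP[/negPf->].
by ring.
Qed.

(** The phase [pi - tau] forces the angle pi, hence real part -1, which in the unit disc only the
    point -1 has. *)
Lemma closing_set1 tau u k : sqn (u 0 k) <= 1 ->
  closing [set k] tau u -> u 0 k = cis tau.
Proof.
move=> u1 /(_ (const_mx (pi - tau))).
rewrite /angsum !big_set1 !mxE subrK cospi.
move=> /(_ erefl) gepi.
have angE : ang (u 0 k) (pi - tau) = pi by apply/eqP; rewrite eq_le ang_lepi.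
have := cos_ang (pi - tau) u1; rewrite angE cosB sinB cospi sinpi.
have := cos2Dsin2 tau; move: u1; rewrite /sqn.
case: (u 0 k) => a b /=; set c := cos tau; set s := sin tau => ab1 cs1 E.
have E2 : (a - c) ^+ 2 + (b - s) ^+ 2 <= 0.
  have -> : (a - c) ^+ 2 + (b - s) ^+ 2 =
      (a ^+ 2 + b ^+ 2) + (c ^+ 2 + s ^+ 2) - (a * c + b * s) *+ 2 by ring.
  by rewrite cs1; lra.
have := sqrD_le0 E2; rewrite addrC in E2; have := sqrD_le0 E2.
by rewrite /cis -/c -/s => ? ?; congr (_ +i* _); lra.
Qed.

(* Contract an edge with |u_k| = 1 if there is one; otherwise u lies between two
   points, obtained by moving one coordinate either way, at which such an edge
   appears or the total angle pi is reached. *)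
Lemma closing_mixture A tau u : A != finset.set0 ->
  (forall j, j \in A -> sqn (u 0 j) <= 1) ->
  closing A tau u -> mixture (torus A tau) u.
Proof.
have [m] := ubnP #|A|; elim: m A tau u => // m IH A tau u Am A0 u1 cl.
have contract (v : 'rV[R[i]]_n) k : (1 < #|A|)%N -> k \in A ->
    (forall j, j \in A -> sqn (v 0 j) <= 1) ->
    sqn (v 0 k) = 1 -> closing A tau v -> mixture (torus A tau) v.
  move=> A1 kA v1 /polar[x xE] clv; apply: (torus_expand kA xE).
  move: Am A1; rewrite (cardsD1 k) kA => Am A1.
  apply: IH => //; first by rewrite -card_gt0.
    by move=> j /setD1P[_ /v1].
  exact: closing_contract.
have [k0 k0A] := set0Pn _ A0.
have [A1|A1] := leqP #|A| 1.
  have {}A1 : A = [set k0]%SET.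
    apply/eqP; rewrite eq_sym eqEcard cards1 A1 andbT.
    by apply/fintype.subsetP => j /set1P ->.
  rewrite A1 in u1 cl *.
  have uE := closing_set1 (u1 _ (set11 k0)) cl.
  apply: mixture_in; exists (const_mx tau).
    by rewrite big_set1 mxE subrr cos0.
  by move=> i /set1P->; rewrite uE mxE.
have [/existsP[k /andP[kA /eqP uk]]|] :=
  boolP [exists k, (k \in A) && (sqn (u 0 k) == 1)].
  exact: contract uk cl.
rewrite negb_exists => /forallP ult.
have {}ult j : j \in A -> sqn (u 0 j) < 1.
  by move=> jA; have := ult j; rewrite jA/= lt_neqAle u1// andbT.
have push s : s ^+ 2 = 1 -> exists2 t, 0 <= t &
    mixture (torus A tau) (shift_coord u k0 (s * t)).
  move=> s2; have [t t0 [clt [ut|[ut [al alE alpi]]]]] :=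
    closing_push s2 k0A ult cl.
    exists t => //; apply: (contract _ k0) => // j jA.
    have [->|/negPf jk] := eqVneq j k0; first by rewrite ut.
    by rewrite mxE jk u1.
  exists t => //; apply: closing_boundary alE alpi => // j jA.
  have [->//|/negPf jk] := eqVneq j k0.
  by rewrite mxE jk ult.
have [t1 t10 m1] := push 1 (expr1n _ _).
have [|t2 t20 m2] := push (-1); first by rewrite sqrrN expr1n.
(* If neither move goes anywhere, [u] is itself one of the two points, and the weights below would
   divide by 0. *)
have [t12|t12] := eqVneq (t1 + t2) 0.
  move: m1; rewrite (_ : t1 = 0); last by lra.
  rewrite mulr0 (_ : shift_coord _ _ _ = u)//.
  by apply/rowP => j; rewrite mxE addr0 if_same.
have t12p : 0 < t1 + t2 by rewrite lt_neqAle eq_sym t12 addr_ge0.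
(* The weights make the shifts by [t1] and [- t2] cancel. *)
rewrite (_ : u = (t2 / (t1 + t2))%:C *: shift_coord u k0 (1 * t1)
    + (1 - t2 / (t1 + t2))%:C *: shift_coord u k0 (-1 * t2)).
  apply: mixture_conv => //; apply/andP; split.
    by rewrite divr_ge0 // ltW.
  by rewrite ler_pdivrMr// mul1r lerDr.
apply/rowP => j; rewrite !mxE; case: eqP => _.
  case: (u 0 j) => a b; apply/eqP; rewrite eq_complex/= !mul0r !addr0 !subr0.
  by apply/andP; split; apply/eqP; field.
by rewrite -mulrDl -rmorphD/= subrKC mul1r.
Qed.

End torus.

Local Open Scope sesquilinear_scope.

(** * Hermitian forms and the spherical triangle inequality *)

Lemma trmxC_scale (R : rcfType) m n (a : R[i]) (M : 'M[R[i]]_(m, n)) :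
  (a *: M) ^t* = a^*%C *: M ^t*.
Proof. by apply/matrixP => i j; rewrite !mxE rmorphM. Qed.

Lemma trmxC_add (R : rcfType) m n (M M' : 'M[R[i]]_(m, n)) :
  (M + M') ^t* = M ^t* + M' ^t*.
Proof. by apply/matrixP => i j; rewrite !mxE rmorphD. Qed.

(** At (- q, p) the form is p (p r - q^2), and symmetrically at (r, - q); if p = r = 0, its values
    at (1, 1) and (1, -1) force q = 0. *)
Lemma psd_discriminant (R : realFieldType) (p q r : R) :
  (forall s t, 0 <= p * s ^+ 2 + q * s * t *+ 2 + r * t ^+ 2) ->
  q ^+ 2 <= p * r.
Proof.
move=> H.
have p0 : 0 <= p.
  by have := H 1 0; rewrite !mulr0 expr1n expr0n/= !mulr0 mul0rn; lra.
have r0 : 0 <= r.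
  by have := H 0 1; rewrite !mulr0 expr1n expr0n/= !mulr0 !mul0r mul0rn; lra.
have [p_gt0|] := ltP 0 p.
  rewrite -subr_ge0 -(pmulr_rge0 _ p_gt0).
  by have := H (- q) p; congr (0 <= _); ring.
have [r_gt0|] := ltP 0 r.
  move=> _; rewrite -subr_ge0 -(pmulr_rge0 _ r_gt0).
  by have := H r (- q); congr (0 <= _); ring.
move=> r_le0 p_le0; have -> : p = 0 by lra.
have r00 : r = 0 by lra.
have := H 1 1; have := H 1 (-1).
rewrite (_ : p = 0); last by lra.
rewrite r00 !mul0r !mulr1 mulrN1 => ? ?.
by rewrite (_ : q = 0) ?expr0n//; lra.
Qed.

Section real_form.
Context {R : realType} {n : nat} (W : 'M[R[i]]_n).
Hypotheses (W_herm : W \is hermsymmx) (W_psd : psdmx W).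
Implicit Types (x y z : 'cV[R[i]]_n) (a b : R[i]) (i j : 'I_n).

Lemma hermE i j : W j i = (W i j)^*.
Proof.
by move/is_hermitianmxP: W_herm; rewrite expr0 scale1r => {1}->; rewrite !mxE.
Qed.

(** A positive semidefinite real inner product: vectors with [rform x x = 1] act as points of a
    sphere, at distance [acos (rform x y)]. *)
Definition rform x y : R := complex.Re ((x ^t* *m W *m y) 0 0).

Lemma rformDl x y z : rform (x + y) z = rform x z + rform y z.
Proof. by rewrite /rform trmxC_add !mulmxDl mxE raddfD. Qed.

Lemma rformDr x y z : rform x (y + z) = rform x y + rform x z.
Proof. by rewrite /rform mulmxDr mxE raddfD. Qed.

Lemma rform_delta a b i j :
  rform (a *: delta_mx i 0) (b *: delta_mx j 0) =
  complex.Re (a^*%C * W i j * b).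
Proof.
rewrite /rform trmxC_scale trmx_delta map_delta_mx -scalemxAl -rowE.
by rewrite -scalemxAl -scalemxAr -colE !mxE mulrCA mulrC.
Qed.

Lemma rformC x y : rform x y = rform y x.
Proof.
rewrite /rform -[RHS](_ : complex.Re ((y ^t* *m W *m x) 0 0)^* = _); last first.
  by case: (_ 0 0).
congr complex.Re; move: W_herm => /is_hermitianmxP; rewrite expr0 scale1r => WE.
rewrite {1}WE.
have -> : x ^t* *m W ^t* *m y = (y ^t* *m W *m x) ^t*.
  by rewrite !trmx_mul !map_mxM trmxCK mulmxA.
by rewrite !mxE.
Qed.

Lemma rformZl (t : R) x y : rform (t%:C *: x) y = t * rform x y.
Proof.
rewrite /rform trmxC_scale -!scalemxAl mxE.
by case: (_ 0 0) => p q /=; rewrite oppr0 !mul0r subr0.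
Qed.

Lemma rformZr (t : R) x y : rform x (t%:C *: y) = t * rform x y.
Proof. by rewrite rformC rformZl rformC. Qed.

Lemma rform_ge0 x : 0 <= rform x x.
Proof. by have := W_psd x; rewrite lecE => /andP[]. Qed.

Lemma rform_quad (s t : R) x y :
  rform (s%:C *: x + t%:C *: y) (s%:C *: x + t%:C *: y) =
  rform x x * s ^+ 2 + rform x y * s * t *+ 2 + rform y y * t ^+ 2.
Proof.
rewrite rformDl (rformDr (_ *: x)) (rformDr (_ *: y)) !rformZl !rformZr.
rewrite (rformC y x).
by move: (rform x x) (rform x y) (rform y y) => p q r; ring.
Qed.

Lemma rform_cauchy_schwarz x y : rform x y ^+ 2 <= rform x x * rform y y.
Proof. by apply: psd_discriminant => s t; rewrite -rform_quad rform_ge0. Qed.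

(** The left side pairs the components of x and z orthogonal to y; Cauchy-Schwarz for these gives
    [rform_cauchy]. *)
Lemma rform_residual x y z : rform y y = 1 ->
  rform (x + (- rform x y)%:C *: y) (z + (- rform z y)%:C *: y) =
  rform x z - rform x y * rform z y.
Proof.
move=> yy; rewrite rformDl !rformDr !rformZl !rformZr yy (rformC y z).
by move: (rform x z) (rform x y) (rform z y) => p q r; ring.
Qed.

Lemma rform_cauchy x y z : rform x x = 1 -> rform y y = 1 -> rform z z = 1 ->
  (rform x z - rform x y * rform y z) ^+ 2 <=
  (1 - rform x y ^+ 2) * (1 - rform y z ^+ 2).
Proof.
move=> xx yy zz.
have [p [q [pp qq <-]]] : exists p q, [/\ rform p p = 1 - rform x y ^+ 2,
    rform q q = 1 - rform y z ^+ 2 &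
    rform p q = rform x z - rform x y * rform y z].
  exists (x + (- rform x y)%:C *: y), (z + (- rform z y)%:C *: y); split.
  - by apply: (etrans (rform_residual x x yy)); rewrite xx.
  - by apply: (etrans (rform_residual z z yy)); rewrite zz (rformC y z).
  - by apply: (etrans (rform_residual x z yy)); rewrite (rformC y z).
by rewrite -pp -qq; exact: rform_cauchy_schwarz.
Qed.

Lemma rform_itv x y : rform x x = 1 -> rform y y = 1 -> -1 <= rform x y <= 1.
Proof.
move=> xx yy; have := rform_cauchy_schwarz x y; rewrite xx yy mulr1 => xy.
rewrite -ler_norml -(@ler_pXn2r _ 2)// ?nnegrE// expr1n.
by rewrite real_normK ?num_real.
Qed.

(** [rform_cauchy] bounds [rform x z] below by the cosine of the right side, and [cos] decreases on
    [0, pi]; a sum above pi is trivial. *)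
Lemma rform_acos_triangle x y z :
  rform x x = 1 -> rform y y = 1 -> rform z z = 1 ->
  acos (rform x z) <= acos (rform x y) + acos (rform y z).
Proof.
move=> xx yy zz; have := rform_cauchy xx yy zz.
have := rform_itv xx zz; have := rform_itv xx yy; have := rform_itv yy zz.
move: (rform x z) (rform x y) (rform y z) => c a b b1 a1 c1 cab.
have [lepi|/ltW gepi] := leP (acos a + acos b) pi; last first.
  by rewrite (le_trans _ gepi)// acos_lepi.
rewrite leNgt -ltr_cos ?in_itv/= ?acos_ge0 ?acos_lepi//
  ?addr_ge0 ?acos_ge0// -leNgt.
rewrite cosD !acosK ?in_itv// !sin_acos//.
have ge0 (d : R) : -1 <= d <= 1 -> 0 <= 1 - d ^+ 2.
  by move=> /andP[? ?]; rewrite -[1](expr1n _ 2) subr_sqr mulr_ge0//; lra.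
rewrite -sqrtrM ?ge0//.
have : Num.sqrt ((c - a * b) ^+ 2) <= Num.sqrt ((1 - a ^+ 2) * (1 - b ^+ 2)).
  exact: ler_wsqrtr.
by rewrite sqrtr_sqr ler_norml => /andP[]; lra.
Qed.

Lemma rform_acos_path (y : nat -> 'cV[R[i]]_n) m :
  (forall k, rform (y k) (y k) = 1) ->
  acos (rform (y 0) (y m)) <= \sum_(k < m) acos (rform (y k) (y k.+1)).
Proof.
move=> y1; elim: m => [|m IH]; first by rewrite big_ord0 y1 acos1.
rewrite big_ord_recr/=; apply: le_trans (lerD IH (lexx _)).
exact: rform_acos_triangle.
Qed.

End real_form.

(** * Minors of order two and rescaling to unit diagonal *)

Lemma mulJ_sqn (R : realType) (z : R[i]) : z * z^*%C = (sqn z)%:C.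
Proof. by rewrite -sqr_normc -add_Re2_Im2. Qed.

Lemma sqnM (R : realType) (x y : R[i]) : sqn (x * y) = sqn x * sqn y.
Proof. by rewrite /sqn; case: x y => a b [c d]/=; ring. Qed.

Lemma sqnJ (R : realType) (x : R[i]) : sqn x^*%C = sqn x.
Proof. by case: x => a b; rewrite /sqn/= sqrrN. Qed.

Lemma trmxCE (R : rcfType) m n (M : 'M[R[i]]_(m, n)) i j :
  (M ^t*) i j = (M j i)^*.
Proof. by rewrite !mxE. Qed.

Lemma hermP (R : realType) n (W : 'M[R[i]]_n) :
  (forall i j, W j i = (W i j)^*) -> W \is hermsymmx.
Proof.
move=> H; apply/is_hermitianmxP; rewrite expr0 scale1r.
by apply/matrixP => i j; rewrite !mxE H.
Qed.

Section psd_minor.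
Context {R : realType} {n : nat} (W : 'M[R[i]]_n).
Hypotheses (W_herm : W \is hermsymmx) (W_psd : psdmx W).

Definition diag_sqrt i : R := Num.sqrt (complex.Re (W i i)).

Lemma psd_diagE i : W i i = (complex.Re (W i i))%:C.
Proof.
have := hermE W_herm i i; case: (W i i) => a b [/eqP].
by rewrite -subr_eq0 opprK -mulr2n mulrn_eq0/= => /eqP ->.
Qed.

Lemma psd_diag_ge0 i : 0 <= complex.Re (W i i).
Proof.
have := rform_ge0 W_psd (1 *: delta_mx i 0).
by rewrite rform_delta rmorph1 mul1r mulr1.
Qed.

(** Cauchy-Schwarz for two basis vectors, the first scaled by [W i j] so that the real part of their
    product is the full |W i j|^2. *)
Lemma psd_minor i j :
  sqn (W i j) <= complex.Re (W i i) * complex.Re (W j j).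
Proof.
set u := W i j.
have := rform_cauchy_schwarz W_herm W_psd
  (u *: delta_mx i 0) (1 *: delta_mx j 0).
have -> : rform W (u *: delta_mx i 0) (1 *: delta_mx j 0) = sqn u.
  by rewrite rform_delta mulr1 mulrC mulJ_sqn.
have -> : rform W (u *: delta_mx i 0) (u *: delta_mx i 0) =
    sqn u * complex.Re (W i i).
  by rewrite rform_delta psd_diagE mulrAC [u^*%C * u]mulrC mulJ_sqn -rmorphM.
have -> : rform W (1 *: delta_mx j 0) (1 *: delta_mx j 0) = complex.Re (W j j).
  by rewrite rform_delta rmorph1 mul1r mulr1.
rewrite -mulrA expr2; have [->|u0] := eqVneq (sqn u) 0.
  by move=> _; rewrite mulr_ge0 ?psd_diag_ge0.
by rewrite ler_pM2l// lt_neqAle eq_sym u0 /sqn addr_ge0 ?sqr_ge0.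
Qed.

Lemma psd_diag0 i j : complex.Re (W i i) = 0 -> W i j = 0.
Proof.
move=> Wi0; have := psd_minor i j; rewrite Wi0 mul0r /sqn.
case: (W i j) => a b /= ab0.
by rewrite (sqrD_le0 ab0); rewrite addrC in ab0; rewrite (sqrD_le0 ab0).
Qed.

Lemma diag_sqrtK i : (diag_sqrt i)%:C ^+ 2 = W i i.
Proof. by rewrite -rmorphXn/= sqr_sqrtr ?psd_diag_ge0// -psd_diagE. Qed.

(* Where W i i = 0 the row of the first summand vanishes, since 0^-1 = 0; the
   second summand puts 1 on the diagonal there. *)
Definition correlation : 'M[R[i]]_n := \matrix_(i, j)
  ((diag_sqrt i)^-1%:C * W i j * (diag_sqrt j)^-1%:C
   + ((i == j) && (diag_sqrt i == 0))%:R).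

Lemma correlation_diag i : correlation i i = 1.
Proof.
rewrite mxE eqxx/=; have [si0|si0] := eqVneq (diag_sqrt i) 0.
  by rewrite si0 invr0 mul0r mul0r add0r.
rewrite addr0 -diag_sqrtK expr2 -!rmorphM/= mulrA mulVf// mul1r mulfV//.
Qed.

(** Where a diagonal entry is 0, semidefiniteness makes the row and column vanish, so both sides are
    0. *)
Lemma correlationE i j : i != j ->
  W i j = (diag_sqrt i)%:C * correlation i j * (diag_sqrt j)%:C.
Proof.
move=> /negPf ij; rewrite mxE ij addr0.
have diag0 k : diag_sqrt k = 0 -> complex.Re (W k k) = 0.
  move=> /eqP; rewrite sqrtr_eq0 => Wk.
  by apply/eqP; rewrite eq_le Wk psd_diag_ge0.
have [/diag0/psd_diag0->|si0] := eqVneq (diag_sqrt i) 0.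
  by rewrite mulr0 mul0r mulr0 mul0r.
have [/diag0/psd_diag0 Wj0|sj0] := eqVneq (diag_sqrt j) 0.
  by rewrite (hermE W_herm j i) Wj0 conjc0 mulr0 mul0r mulr0 mul0r.
have inj k : diag_sqrt k != 0 -> (diag_sqrt k)%:C * (diag_sqrt k)^-1%:C = 1.
  by move=> k0; rewrite -rmorphM/= mulfV.
rewrite -[LHS]mul1r -[LHS]mulr1 -{1}(inj i)// -(inj j)//; ring.
Qed.

Lemma correlation_herm : correlation \is hermsymmx.
Proof.
apply: hermP => i j; rewrite !mxE (hermE W_herm i j).
rewrite rmorphD !rmorphM rmorph_nat/=.
have conjE (x : R) : x -i* 0 = x%:C by rewrite oppr0.
rewrite !conjE; congr (_ + _); first by ring.
by rewrite eq_sym; case: eqP => // ->.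
Qed.

(** A diagonal congruence of [W] plus a nonnegative diagonal matrix. *)
Lemma correlation_psd : psdmx correlation.
Proof.
move=> x.
have conjE (t : R) : t -i* 0 = t%:C by rewrite oppr0.
pose y : 'cV[R[i]]_n := \col_i ((diag_sqrt i)^-1%:C * x i 0).
have -> : (x ^t* *m correlation *m x) 0 0 =
  (y ^t* *m W *m y) 0 0 + \sum_i (diag_sqrt i == 0)%:R * (x i 0 * (x i 0)^*%C).
  rewrite !mxE (eq_bigr (fun k => (y ^t* *m W) 0 k * y k 0
     + (diag_sqrt k == 0)%:R * (x k 0 * (x k 0)^*))) ?big_split// => k _.
  rewrite !mxE big_distrl [in RHS]big_distrl/=.
  under eq_bigr => j _ do rewrite !mxE mulrDr mulrDl.
  rewrite big_split/=; congr (_ + _).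
    apply: eq_bigr => j _; rewrite trmxCE !mxE -[Num.conj (x j 0)]/((x j 0)^*).
    by rewrite rmorphM/= conjE; ring.
  rewrite (bigD1 k)//= eqxx big1 ?addr0 => [|j /negPf->]; last first.
    by rewrite mulr0 mul0r.
  by rewrite /=; ring.
rewrite addr_ge0// sumr_ge0// => i _; rewrite mulr_ge0 ?mulcJ_ge0//.
Qed.

End psd_minor.

Lemma conjcM (R : rcfType) (x y : R[i]) : (x * y)^*%C = x^*%C * y^*%C.
Proof. exact: rmorphM. Qed.

Lemma conjcD (R : rcfType) (x y : R[i]) : (x + y)^*%C = x^*%C + y^*%C.
Proof. exact: rmorphD. Qed.

(** * Rank one matrices with a prescribed diagonal *)

Section tightness.
Context {R : realType} {n : nat}.
Implicit Types (W X : 'M[R[i]]_n) (e : rel 'I_n).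

Definition rank_ones W : set 'M[R[i]]_n := [set X | exists2 v : 'cV[R[i]]_n,
  X = v *m v ^t* & forall i, v i 0 * (v i 0)^*%C = W i i].

(* Power injections only depend on the diagonal of W and on its entries at the
   lines; the mixtures of [rank_ones W] all have the diagonal of W. *)
Definition tight e := forall W, W \is hermsymmx -> psdmx W ->
  exists2 X, mixture (rank_ones W) X & forall i j, e i j -> X i j = W i j.

Lemma rank_one_coef (v : 'cV[R[i]]_n) i j :
  (v *m v ^t*) i j = v i 0 * (v j 0)^*%C.
Proof. by rewrite mxE big_ord1 trmxCE. Qed.

Lemma mixture_coef W X : mixture (rank_ones W) X ->
  (forall i, X i i = W i i) /\ (forall i j, X j i = (X i j)^*%C).
Proof.
elim=> {X} [X [v -> vW]|t X Y _ _ [XW XH] _ [YW YH]].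
  split=> [i|i j]; rewrite !rank_one_coef//.
  by rewrite conjcM conjcK mulrC.
split=> [i|i j]; rewrite !mxE.
  by rewrite XW YW -mulrDl -rmorphD/= subrKC mul1r.
by rewrite XH YH conjcD !conjcM !conjc_real.
Qed.

End tightness.

(** * Phases and cycles *)

Lemma cisD (R : realType) (x y : R) : cis (x + y) = cis x * cis y.
Proof.
by rewrite /cis cosD sinD; apply/eqP; rewrite eq_complex/= eqxx addrC eqxx.
Qed.

Lemma cisN (R : realType) (x : R) : cis (- x) = (cis x)^*%C.
Proof. by rewrite /cis cosN sinN. Qed.

Lemma cis0 (R : realType) : cis (0 : R) = 1.
Proof. by rewrite /cis cos0 sin0. Qed.

Lemma cisMJ (R : realType) (x : R) : cis x * (cis x)^*%C = 1.
Proof. by rewrite -cisN -cisD subrr cis0. Qed.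

Lemma cis_eq1 (R : realType) (x : R) : cos x = 1 -> cis x = 1.
Proof.
move=> c; have := cos2Dsin2 x; rewrite /cis c expr1n => /eqP.
by rewrite -subr_eq0 addrC addKr sqrf_eq0 => /eqP ->.
Qed.

Lemma cis_eqN1 (R : realType) (x : R) : cos x = -1 -> cis x = -1.
Proof.
move=> c; have := cos2Dsin2 x; rewrite /cis c sqrrN expr1n => /eqP.
rewrite -subr_eq0 addrC addKr sqrf_eq0 => /eqP ->.
by apply/eqP; rewrite eq_complex/= oppr0 !eqxx.
Qed.

Section cycle.
Context {R : realType} {n m : nat} (c : nat -> 'I_n) (W : 'M[R[i]]_n).
Hypotheses (W_herm : W \is hermsymmx) (W_psd : psdmx W).
Hypothesis c_closed : c m.+1 = c 0.
Hypothesis W_diag1 : forall i, W i i = 1.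

Definition cycle_entries : 'rV[R[i]]_m.+1 := \row_(k < m.+1) W (c k) (c k.+1).

Lemma cycle_entries_le1 k : sqn (cycle_entries 0 k) <= 1.
Proof.
by have := psd_minor W_herm W_psd (c k) (c k.+1); rewrite mxE !W_diag1/= mulr1.
Qed.

(** The basis vectors along the cycle, turned by the partial sums of [alpha], form a path of unit
    vectors from one to its opposite; its steps have the angles summed in [angsum]. *)
Lemma cycle_closing : closing [set: 'I_m.+1]%SET 0 cycle_entries.
Proof.
have sumT (F : 'I_m.+1 -> R) : \sum_(i in [set: 'I_m.+1]%SET) F i = \sum_i F i.
  by apply: eq_bigl => i; rewrite inE.
move=> alpha; rewrite addr0 sumT => alphaE.
pose sigma k := \sum_(j < k) alpha 0 (inord j).
pose y k : 'cV[R[i]]_n := cis (sigma k) *: delta_mx (c k) 0.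
have y1 k : rform W (y k) (y k) = 1.
  by rewrite rform_delta W_diag1 mulr1 mulrC cisMJ.
have -> : pi = acos (rform W (y 0) (y m.+1)) :> R.
  rewrite rform_delta c_closed W_diag1 mulr1 /sigma big_ord0 cis0 rmorph1 mul1r.
  rewrite (eq_bigr (fun j => alpha 0 j)) => [|j _]; last by rewrite inord_val.
  by rewrite cis_eqN1// acosN1.
apply: le_trans (rform_acos_path W_herm W_psd m.+1 y1) _.
rewrite /angsum sumT le_eqVlt; apply/predU1P; left; apply: eq_bigr => k _.
have -> : y k.+1 = (cis (sigma k) * cis (alpha 0 k)) *: delta_mx (c k.+1) 0.
  by rewrite /y /sigma big_ord_recr/= inord_val cisD.
rewrite rform_delta.
rewrite (_ : _ * _ = W (c k) (c k.+1) * cis (alpha 0 k)); last first.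
  by rewrite -[RHS]mul1r -(cisMJ (sigma k)); ring.
rewrite /ang clamp_id ?rot_itv ?cycle_entries_le1// mxE.
by case: (W _ _).
Qed.

End cycle.

(** The phases of v are the negated partial sums of [theta]. As the full sum is 0 modulo 2 pi, they
    also fit the last edge, back to [c 0]. *)
Lemma torus_rank_one (R : realType) (n m : nat) (c : nat -> 'I_n)
    (W : 'M[R[i]]_n) (z : 'rV[R[i]]_m.+1) :
  W \is hermsymmx -> psdmx W -> c m.+1 = c 0 ->
  (forall k l, k <= m -> l <= m -> c k = c l -> k = l)%N ->
  (forall i, exists2 k, k <= m & i = c k)%N ->
  torus [set: 'I_m.+1]%SET 0 z ->
  exists2 X, rank_ones W X & forall k : 'I_m.+1, X (c k) (c k.+1) =
    (diag_sqrt W (c k))%:C * z 0 k * (diag_sqrt W (c k.+1))%:C.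
Proof.
move=> W_herm W_psd c_closed c_inj c_surj [theta thetaE zE].
have sumT (F : 'I_m.+1 -> R) : \sum_(i in [set: 'I_m.+1]%SET) F i = \sum_i F i.
  by apply: eq_bigl => i; rewrite inE.
pose sigma k := \sum_(j < k) theta 0 (inord j).
have [v vE] : exists v : 'cV[R[i]]_n, forall k, (k <= m)%N ->
    v (c k) 0 = (diag_sqrt W (c k))%:C * cis (- sigma k).
  have [idx idxm idxE] := fin_all_exists2 c_surj.
  exists (\col_i ((diag_sqrt W i)%:C * cis (- sigma (idx i)))) => k km.
  by rewrite mxE (c_inj (idx (c k)) k)// -idxE.
have vE' k : (k <= m.+1)%N ->
    v (c k) 0 = (diag_sqrt W (c k))%:C * cis (- sigma k).
  rewrite leq_eqVlt => /predU1P[->|/vE//].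
  rewrite c_closed vE// /sigma big_ord0 oppr0 cis0 cisN cis_eq1 ?conjc1//.
  rewrite -thetaE subr0 sumT; congr cos; apply: eq_bigr => j _.
  by rewrite inord_val.
exists (v *m v ^t*).
  exists v => // i; have [k km ->] := c_surj i.
  rewrite vE// conjcM conjc_real mulrACA cisMJ mulr1 -expr2.
  exact: diag_sqrtK.
move=> k; rewrite rank_one_coef (vE' k) 1?ltnW// (vE' k.+1)// conjcM conjc_real.
rewrite zE ?inE// -cisN opprK.
have -> : sigma k.+1 = sigma k + theta 0 k.
  by rewrite /sigma big_ord_recr/= inord_val.
rewrite (_ : cis (theta 0 k) = cis (- sigma k) * cis (sigma k + theta 0 k)).
  by ring.
by rewrite -cisD addrA addNr add0r.
Qed.

Lemma mixture_torus_rank_ones (R : realType) (n m : nat) (c : nat -> 'I_n)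
    (W : 'M[R[i]]_n) (u : 'rV[R[i]]_m.+1) :
  W \is hermsymmx -> psdmx W -> c m.+1 = c 0 ->
  (forall k l, k <= m -> l <= m -> c k = c l -> k = l)%N ->
  (forall i, exists2 k, k <= m & i = c k)%N ->
  mixture (torus [set: 'I_m.+1]%SET 0) u ->
  exists2 X, mixture (rank_ones W) X & forall k : 'I_m.+1, X (c k) (c k.+1) =
    (diag_sqrt W (c k))%:C * u 0 k * (diag_sqrt W (c k.+1))%:C.
Proof.
move=> W_herm W_psd c_closed c_inj c_surj.
elim=> {u} [z zT|t u v t01 _ [X mX XE] _ [Y mY YE]].
  have [X X1 XE] := torus_rank_one W_herm W_psd c_closed c_inj c_surj zT.
  by exists X => //; exact: mixture_in.
exists (t%:C *: X + (1 - t)%:C *: Y); first exact: mixture_conv.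
by move=> k; rewrite !mxE XE YE; ring.
Qed.

Lemma tight_cycle (R : realType) (n : nat) (e : rel 'I_n) :
  cycle_graph e -> @tight R n e.
Proof.
case=> -[|x0 s]; first by case.
set p := x0 :: s; set m := size s => -[p_uniq p_size p_all eE] W W_herm W_psd.
(* Indices are read modulo the length, so that the last line returns to the first bus. *)
pose c k := nth x0 p (k %% m.+1).
have cE k : (k <= m)%N -> c k = nth x0 p k by move=> km; rewrite /c modn_small.
have c_closed : c m.+1 = c 0 by rewrite /c modnn.
have c_inj k l : (k <= m -> l <= m -> c k = c l -> k = l)%N.
  by move=> km lm; rewrite !cE// => /eqP; rewrite nth_uniq// => /eqP.
have c_surj i : (exists2 k, k <= m & i = c k)%N.
  have ip := p_all i; exists (index i p).
    by rewrite -ltnS -[m.+1]/(size p) index_mem.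
  by rewrite cE ?nth_index// -ltnS -[m.+1]/(size p) index_mem.
have nextE k : (k <= m)%N -> next p (c k) = c k.+1.
  move=> km; rewrite next_nth p_all cE// index_uniq//.
  move: km; rewrite leq_eqVlt => /predU1P[->|km].
    by rewrite c_closed cE// /p/= nth_default.
  by rewrite cE.
(* The unit diagonal is what [cycle_closing] requires; [correlationE] scales back. *)
pose U := correlation W.
have U_herm : U \is hermsymmx := correlation_herm W_herm.
have U_psd : psdmx U := correlation_psd W_psd.
have U_diag i : U i i = 1 := correlation_diag W_herm W_psd i.
have T0 : [set: 'I_m.+1]%SET != finset.set0.
  by apply/set0Pn; exists ord0; rewrite inE.
have := closing_mixture T0
  (fun k _ => cycle_entries_le1 c U_herm U_psd U_diag k)
  (cycle_closing U_herm U_psd c_closed U_diag).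
move=> /(mixture_torus_rank_ones W_herm W_psd c_closed c_inj c_surj)[X mX XE].
have [_ X_herm] := mixture_coef mX.
have cS k : (k <= m)%N -> c k != c k.+1.
  rewrite leq_eqVlt => /predU1P[->|km].
    by rewrite c_closed !cE// nth_uniq// -lt0n; apply: ltnW.
  by rewrite (cE k) 1?ltnW// cE// nth_uniq// ?ltn_eqF// ltnS ltnW.
have XW k : (k <= m)%N -> X (c k) (c k.+1) = W (c k) (c k.+1).
  move=> km; rewrite (XE (Ordinal (km : (k < m.+1)%N))) mxE -correlationE//.
  exact: cS.
exists X => // i j; rewrite eE => /predU1P[->|/eqP->].
  by have [k km ->] := c_surj i; rewrite nextE// XW.
have [k km ->] := c_surj j; rewrite nextE// X_herm (hermE W_herm (c k)) XW//.
Qed.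

(** * Trees *)

Lemma disc_mixture (R : realType) (z : R[i]) (r : R) : sqn z <= r ->
  exists t w1 w2, [/\ 0 <= t <= 1, sqn w1 = r, sqn w2 = r
    & z = t%:C * w1 + (1 - t)%:C * w2].
Proof.
case: z => a b; rewrite /sqn/= => ab.
(* z is on the horizontal chord of the circle between h + ib and - h + ib; when
   h = 0 the quotient a / h below is 0, which is fine as a = 0. *)
pose h := Num.sqrt (r - b ^+ 2).
have h2 : h ^+ 2 = r - b ^+ 2.
  by rewrite sqr_sqrtr// subr_ge0 (le_trans _ ab)// lerDr sqr_ge0.
have ah : `|a| <= h by rewrite -sqrtr_sqr ler_wsqrtr// lerBrDr.
have ahK : a / h * h = a.
  have [h0|h0] := eqVneq h 0; last by rewrite divfK.
  by move: ah; rewrite h0 normr_le0 => /eqP ->; rewrite !mul0r.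
have /andP[ahN1 ah1] : -1 <= a / h <= 1.
  have [h0|h0] := eqVneq h 0.
    by rewrite h0 invr0 mulr0; apply/andP; split; lra.
  have hp : 0 < h by rewrite lt_neqAle eq_sym h0 sqrtr_ge0.
  by rewrite -ler_norml normrM normfV (gtr0_norm hp) ler_pdivrMr// mul1r.
exists ((1 + a / h) / 2), (h +i* b), ((- h) +i* b); split.
- by apply/andP; split; lra.
- by rewrite /= h2; ring.
- by rewrite /= sqrrN h2; ring.
- apply/eqP; rewrite eq_complex/= !mul0r !subr0 !addr0.
  apply/andP; split; apply/eqP.
    by rewrite -[LHS]ahK; move: (a / h) => q; field.
  by move: (a / h) => q; field.
Qed.

Section acyclic.
Context {R : realType} {n : nat} (W : 'M[R[i]]_n).
Hypotheses (W_herm : W \is hermsymmx) (W_psd : psdmx W).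

(** In each rank one term only [v x 0] changes. The value matching [W x y] lies in the disc of
    radius [diag_sqrt W x] by [psd_minor], hence between two points of its circle. *)
Lemma rank_ones_extend X x y : x != y -> mixture (rank_ones W) X ->
  exists2 X', mixture (rank_ones W) X' & X' x y = W x y /\
    forall i j, i != x -> j != x -> X' i j = X i j.
Proof.
move=> xy.
elim=> {X} [X [v -> vW]|t X Y t01 _ [X' mX [XE XX]] _ [Y' mY [YE YY]]];
  last first.
  exists (t%:C *: X' + (1 - t)%:C *: Y'); first exact: mixture_conv.
  split=> [|i j ix jx]; rewrite !mxE.
    by rewrite XE YE -mulrDl -rmorphD/= subrKC mul1r.
  by rewrite XX// YY.
have sqnv i : sqn (v i 0) = complex.Re (W i i) by rewrite -vW mulJ_sqn.
(* If [v y 0 = 0] the quotient is 0, and so is [W x y], because [W y y = 0]. *)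
pose z := W x y / (v y 0)^*%C.
have zW : z * (v y 0)^*%C = W x y.
  have [vy0|vy0] := eqVneq (v y 0) 0; last by rewrite mulfVK// conjc_eq0.
  rewrite vy0 conjc0 mulr0 (hermE W_herm y) (psd_diag0 W_herm W_psd) ?conjc0//.
  by rewrite -sqnv vy0 /sqn/= !expr0n addr0.
have z_le : sqn z <= complex.Re (W x x).
  have [vy0|vy0] := eqVneq (v y 0) 0.
    rewrite /z vy0 conjc0 invr0 mulr0 /sqn/= !expr0n/= addr0.
    exact: psd_diag_ge0.
  have : sqn (z * (v y 0)^*%C) <= complex.Re (W x x) * complex.Re (W y y).
    by rewrite zW psd_minor.
  rewrite -(sqnv y) sqnM sqnJ.
  rewrite ler_pM2r// lt_neqAle eq_sym.
  apply/andP; split; last by rewrite sqnv psd_diag_ge0.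
  apply: contraNneq vy0 => sv0; have := mulJ_sqn (v y 0).
  by rewrite sv0 => /eqP; rewrite mulf_eq0 conjc_eq0 orbb.
have [t [w1 [w2 [t01 w1W w2W zE]]]] := disc_mixture z_le.
pose u w : 'cV[R[i]]_n := \col_i if i == x then w else v i 0.
have uP w : sqn w = complex.Re (W x x) -> rank_ones W (u w *m (u w) ^t*).
  move=> wW; exists (u w) => // i; rewrite !mxE; case: eqP => [->|_]//.
  by rewrite mulJ_sqn wW -psd_diagE.
exists (t%:C *: (u w1 *m (u w1) ^t*) + (1 - t)%:C *: (u w2 *m (u w2) ^t*)).
  by apply: mixture_conv => //; apply: mixture_in; apply: uP.
have off w i j : i != x -> j != x -> (u w *m (u w) ^t*) i j = (v *m v ^t*) i j.
  by move=> /negPf ix /negPf jx; rewrite !rank_one_coef !mxE ix jx.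
split=> [|i j ix jx]; rewrite mxE [X in X + _]mxE [X in _ + X]mxE; last first.
  by rewrite !off// -mulrDl -rmorphD/= subrKC mul1r.
by rewrite !rank_one_coef !mxE eqxx eq_sym (negPf xy) !mulrA -mulrDl -zE.
Qed.

End acyclic.

(* x is an end of a longest simple path in A. *)
Lemma acyclic_leaf (T : finType) (e : rel T) (A : {set T}) :
  symmetric e -> irreflexive e ->
  (forall c : seq T, (2 < size c)%N -> ~ ucycle e c) -> A != finset.set0 ->
  exists2 x, x \in A & exists y, forall z, z \in A -> e x z -> z = y.
Proof.
move=> e_sym e_irr e_acyc /set0Pn[a0 a0A].
pose simple x p := [&& path e x p, uniq (x :: p) & all [in A] (x :: p)].
pose P k := `[< exists x p, simple x p /\ size p = k >].
have P0 : exists k, P k.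
  by exists 0%N; apply/asboolP; exists a0, [::]; rewrite /simple/= a0A.
have Pmax k : P k -> (k <= #|T|)%N.
  move=> /asboolP[x [p [/and3P[_ px _] <-]]].
  by rewrite (leq_trans _ (max_card (mem (x :: p))))// (card_uniqP px)/=.
case: (ex_maxnP P0 Pmax) => k /asboolP[x [p [/and3P[xp xp_uniq xpA] pk]]] kmax.
exists x; first by case/andP: xpA.
exists (head x p) => z zA xz.
have zx : z != x by apply: contraTneq xz => ->; rewrite e_irr.
have : z \in p.
  apply: contraT => zp; have : P k.+1.
    apply/asboolP; exists z, (x :: p); split; last by rewrite /= pk.
    rewrite /simple/= e_sym xz xp inE negb_or zx zp zA.
    by move: xp_uniq xpA => /= -> ->.
  by move=> /kmax; rewrite ltnn.
case/splitPr def_p: p / => [p1 p2].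
move: xp xp_uniq; rewrite def_p; case: p1 def_p => [//|y p1] _ xp xp_uniq.
case: (e_acyc (x :: rcons (y :: p1) z)); first by rewrite /= size_rcons.
move: xp xp_uniq; rewrite -cat_rcons /ucycle -cat_cons.
rewrite cat_path cat_uniq => /andP[xp _] /andP[-> _].
by rewrite /cycle rcons_path xp last_rcons e_sym xz.
Qed.

(** Induction on a set of buses: a leaf is put back last, which settles its only line in the set and
    disturbs no other. *)
Lemma tight_acyclic (R : realType) (n : nat) (e : rel 'I_n) :
  symmetric e -> irreflexive e ->
  (forall c : seq 'I_n, (2 < size c)%N -> ~ ucycle e c) -> @tight R n e.
Proof.
move=> e_sym e_irr e_acyc W W_herm W_psd.
suff H (A : {set 'I_n}) : exists2 X, mixture (rank_ones W) X &
    forall i j, i \in A -> j \in A -> e i j -> X i j = W i j.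
  by have [X mX XE] := H [set: 'I_n]%SET; exists X => // i j; apply: XE.
have [m] := ubnP #|A|; elim: m A => // m IH A Am.
have [->|A0] := eqVneq A finset.set0.
  pose v : 'cV[R[i]]_n := \col_i (diag_sqrt W i)%:C.
  exists (v *m v ^t*); last by move=> i j; rewrite inE.
  apply: mixture_in; exists v => // i.
  by rewrite !mxE conjc_real -expr2; exact: diag_sqrtK.
have [x xA [y xy]] := acyclic_leaf e_sym e_irr e_acyc A0.
have [|X mX XE] := IH (A :\ x)%SET; first by move: Am; rewrite (cardsD1 x) xA.
have [X' mX' [XW XX]] : exists2 X', mixture (rank_ones W) X' &
    (forall z, z \in A -> e x z -> X' x z = W x z) /\
    forall i j, i != x -> j != x -> X' i j = X i j.
  (* [y] can only be [x] when [x] has no neighbour left in [A]. *)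
  have [yx|yx] := eqVneq x y.
    exists X => //; split=> // z zA xz.
    by have := xz; rewrite (xy z)// -yx e_irr.
  have [X' mX' [XW XX]] := rank_ones_extend W_herm W_psd yx mX.
  by exists X' => //; split=> // z zA xz; rewrite (xy z).
have [_ X_herm] := mixture_coef mX'.
exists X' => // i j iA jA ij.
have [ix|ix] := eqVneq i x; first by rewrite ix in ij *; apply: XW.
have [jx|jx] := eqVneq j x.
  by rewrite jx in ij *; rewrite X_herm (hermE W_herm x) XW// e_sym.
by rewrite XX// XE// !inE ?ix ?jx.
Qed.

(** * 1-connections *)

Section reindex.
Context {R : realType} {n m : nat} (f : 'I_m -> 'I_n) (W : 'M[R[i]]_n).

Lemma mxsub_herm : W \is hermsymmx -> mxsub f f W \is hermsymmx.
Proof. by move=> W_herm; apply: hermP => i j; rewrite !mxE; exact: hermE. Qed.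

(** The submatrix is a compression of [W] by the matrix [P] that selects rows. *)
Lemma mxsub_psd : psdmx W -> psdmx (mxsub f f W).
Proof.
move=> W_psd x; pose P : 'M[R[i]]_(m, n) := rowsub f 1%:M.
have -> : mxsub f f W = P *m W *m P ^t*.
  rewrite -rowsubE; apply/matrixP => a b.
  rewrite [RHS]mxE (bigD1 (f b))//= big1 => [|k kfb].
    by rewrite trmxCE !mxE eqxx rmorph1 mulr1 addr0.
  by rewrite trmxCE !mxE eq_sym (negPf kfb) rmorph0 mulr0.
have -> : x ^t* *m (P *m W *m P ^t*) *m x =
    (P ^t* *m x) ^t* *m W *m (P ^t* *m x).
  by rewrite trmx_mul map_mxM trmxCK !mulmxA.
exact: W_psd.
Qed.

End reindex.

Lemma unit_align (R : realType) (x y : R[i]) : x * x^*%C = y * y^*%C ->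
  exists2 w : R[i], w * w^*%C = 1 & x = w * y.
Proof.
move=> xy; have [y0|y0] := eqVneq y 0.
  exists 1; first by rewrite rmorph1 mulr1.
  move/eqP: xy; rewrite y0 mul0r mulr0 mulf_eq0 conjc_eq0 orbb => /eqP //.
exists (x / y); last by rewrite divfK.
by rewrite conjcM conjc_inv mulrACA xy -invfM mulfV// mulf_neq0// conjc_eq0.
Qed.

(* The two components are mixed independently; the vector of the second one is
   turned by a phase so that it agrees with the first one at the common bus. *)
Lemma rank_ones_glue (R : realType) (n m1 m2 : nat) (W : 'M[R[i]]_n)
    (f : 'I_m1 -> 'I_n) (g : 'I_m2 -> 'I_n) (a0 : 'I_m1) (b0 : 'I_m2) X1 X2 :
  injective f -> injective g ->
  (forall k, (exists a, k = f a) \/ (exists b, k = g b)) ->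
  (forall a b, f a = g b <-> a = a0 /\ b = b0) ->
  mixture (rank_ones (mxsub f f W)) X1 ->
  mixture (rank_ones (mxsub g g W)) X2 ->
  exists2 X, mixture (rank_ones W) X & mxsub f f X = X1 /\ mxsub g g X = X2.
Proof.
move=> f_inj g_inj cover common m1X m2X.
have mxsubD k (h : 'I_k -> 'I_n) (t : R) (X Y : 'M[R[i]]_n) :
    mxsub h h (t%:C *: X + (1 - t)%:C *: Y) =
    t%:C *: mxsub h h X + (1 - t)%:C *: mxsub h h Y.
  by apply/matrixP => i j; rewrite !mxE.
have conv_id (V : lmodType R[i]) (t : R) (x : V) :
    t%:C *: x + (1 - t)%:C *: x = x.
  by rewrite -scalerDl -rmorphD/= subrKC scale1r.
(* One mixture is unfolded at a time; the matrix of the other component is a combination of itself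
   with itself, by [conv_id]. *)
elim: m1X X2 m2X => {X1} [_ [v1 -> v1W]|t X1 Y1 t01 _ IHX _ IHY] X2 m2X;
  last first.
  have [X mX [X1E X2E]] := IHX _ m2X; have [Y mY [Y1E Y2E]] := IHY _ m2X.
  exists (t%:C *: X + (1 - t)%:C *: Y); first exact: mixture_conv.
  by rewrite !mxsubD X1E X2E Y1E Y2E conv_id.
elim: m2X => {X2} [_ [v2 -> v2W]|
  t X2 Y2 t01 _ [X mX [X1E X2E]] _ [Y mY [Y1E Y2E]]]; last first.
  exists (t%:C *: X + (1 - t)%:C *: Y); first exact: mixture_conv.
  by rewrite !mxsubD X1E X2E Y1E Y2E conv_id.
have fg0 : f a0 = g b0 by apply/common.
have [|w wJ v12] := @unit_align R (v1 a0 0) (v2 b0 0).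
  by rewrite v1W v2W !mxE fg0.
pose v : 'cV[R[i]]_n := \col_k
  if [pick a | f a == k] is Some a then v1 a 0
  else if [pick b | g b == k] is Some b then w * v2 b 0 else 0.
have vf a : v (f a) 0 = v1 a 0.
  by rewrite mxE; case: pickP => [a' /eqP/f_inj ->|/(_ a)]//; rewrite eqxx.
have vg b : v (g b) 0 = w * v2 b 0.
  rewrite mxE; case: pickP => [a /eqP/common[-> ->]//|_].
  by case: pickP => [b' /eqP/g_inj ->|/(_ b)]//; rewrite eqxx.
have vgJ b b' : v (g b) 0 * (v (g b') 0)^*%C = v2 b 0 * (v2 b' 0)^*%C.
  by rewrite !vg conjcM mulrACA wJ mul1r.
exists (v *m v ^t*).
  apply: mixture_in; exists v => // k; have [[a ->]|[b ->]] := cover k.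
    by rewrite vf v1W mxE.
  by rewrite vgJ v2W mxE.
split; apply/matrixP => i j; rewrite mxE !rank_one_coef; last exact: vgJ.
by rewrite !vf.
Qed.

Lemma tight_one_connection (R : realType) (n m1 m2 : nat)
    (K : network R n) (G : network R m1) (H : network R m2) :
  one_connection K G H -> @tight R _ (line G) -> @tight R _ (line H) ->
  @tight R _ (line K).
Proof.
move=> [f [g [a0 [b0 [[f_inj g_inj]
  [cover [common [lineG [lineH [cross _]]]]]]]]]].
move=> tG tH W W_herm W_psd.
have [X1 m1X X1E] := tG _ (mxsub_herm f W_herm) (mxsub_psd f W_psd).
have [X2 m2X X2E] := tH _ (mxsub_herm g W_herm) (mxsub_psd g W_psd).
have [X mX [XX1 XX2]] := rank_ones_glue f_inj g_inj cover common m1X m2X.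
exists X => //.
have fg0 : f a0 = g b0 by apply/common.
have XG a a' : line K (f a) (f a') -> X (f a) (f a') = W (f a) (f a').
  by rewrite lineG => /X1E; rewrite -XX1 !mxE.
have XH b b' : line K (g b) (g b') -> X (g b) (g b') = W (g b) (g b').
  by rewrite lineH => /X2E; rewrite -XX2 !mxE.
(* A line between the two sides ends at the common bus, so it lies inside one component. *)
have XGH a b : line K (f a) (g b) -> X (f a) (g b) = W (f a) (g b).
  have [->|aa0] := eqVneq a a0; first by rewrite fg0; exact: XH.
  have [->|bb0] := eqVneq b b0; first by rewrite -fg0; exact: XG.
  by rewrite (negPf (cross a b aa0 bb0)).
have [_ X_herm] := mixture_coef mX.
move=> i j; have [[a ->]|[b ->]] := cover i; have [[a' ->]|[b' ->]] := cover j.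
- exact: XG.
- exact: XGH.
- by rewrite line_symmetric => /XGH XE; rewrite (X_herm (f a')) XE -hermE.
- exact: XH.
Qed.

Lemma tight_network (R : realType) (n : nat) (N : network R n) :
  one_connected_cycles_trees N -> @tight R n (line N).
Proof.
elim=> {n N} [n N [_]|n N [_]|n m1 m2 K G H _ tG _ tH KGH].
- exact: tight_cycle.
- by apply: tight_acyclic; [exact: line_symmetric|exact: line_irreflexive].
- exact: tight_one_connection KGH tG tH.
Qed.

(** * Injection regions *)

Lemma Re_diag_lin (R : realType) (n : nat) (Y X X' : 'M[R[i]]_n) (t s : R) :
  Re_diag ((t%:C *: X + s%:C *: X') *m Y) =
  t *: Re_diag (X *m Y) + s *: Re_diag (X' *m Y).
Proof.
rewrite mulmxDl -!scalemxAl; move: (X *m Y) (X' *m Y) => A B.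
apply/colP => i; rewrite !mxE raddfD/=.
by case: (A i i) (B i i) => a b [c d]/=; rewrite !mul0r !subr0.
Qed.

(** The bus admittance matrix vanishes off the diagonal and the lines. *)
Lemma Re_diag_bus (R : realType) (n : nat) (N : network R n)
    (X W : 'M[R[i]]_n) :
  (forall i, X i i = W i i) -> (forall i j, line N i j -> X i j = W i j) ->
  Re_diag (X *m (bus_admittance N) ^t*) = Re_diag (W *m (bus_admittance N) ^t*).
Proof.
move=> XW XL; apply/colP => i; rewrite !mxE; congr complex.Re.
apply: eq_bigr => k _; rewrite trmxCE !mxE.
have [<-|ik] := eqVneq i k; first by rewrite XW.
have [ikl|_] := boolP (line N i k); first by rewrite XL.
by rewrite conjc0 !mulr0.
Qed.

Lemma relaxed_injection_region_convex (R : realType) (n : nat) (Y : 'M[R[i]]_n)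
    (Vmin Vmax : 'I_n -> R) :
  @convex_set R 'cV[R]_n (relaxed_injection_region Y Vmin Vmax).
Proof.
move=> _ _ t /set_mem[W [W_herm -> Wb W_psd]]
  /set_mem[W' [W'_herm -> W'b W'_psd]].
have t0 : 0 <= t%:num :> R by [].
have t1 : 0 <= 1 - t%:num :> R by rewrite subr_ge0.
apply/mem_set; exists ((t%:num)%:C *: W + (1 - t%:num)%:C *: W'); split.
- apply: hermP => i j; rewrite !mxE (hermE W_herm i) (hermE W'_herm i).
  by rewrite conjcD !conjcM !conjc_real.
- by rewrite Re_diag_lin.
- move=> i; rewrite !mxE.
  have comb (a : R) : a%:C = (t%:num)%:C * a%:C + (1 - t%:num)%:C * a%:C.
    by rewrite -mulrDl -rmorphD/= subrKC mul1r.
  have /andP[l u] := Wb i; have /andP[l' u'] := W'b i.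
  rewrite (comb (Vmin i ^+ 2)) (comb (Vmax i ^+ 2)).
  by rewrite !lerD// ler_wpM2l ?ler0c.
- move=> x; rewrite mulmxDr mulmxDl -!scalemxAr -!scalemxAl.
  rewrite mxE [X in X + _]mxE [X in _ + X]mxE.
  by rewrite addr_ge0// mulr_ge0 ?ler0c//.
Qed.

Lemma injection_region_sub_relaxed (R : realType) (n : nat) (Y : 'M[R[i]]_n)
    (Vmin Vmax : 'I_n -> R) : (forall i, 0 <= Vmin i) ->
  injection_region Y Vmin Vmax `<=` relaxed_injection_region Y Vmin Vmax.
Proof.
move=> V0 _ [v [-> vb]]; exists (v *m v ^t*); split=> //.
- by apply: hermP => i j; rewrite !rank_one_coef conjcM conjcK mulrC.
- move=> i; rewrite rank_one_coef -sqr_normc !rmorphXn/=.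
  have /andP[l u] := vb i.
  have Vmax0 : 0 <= Vmax i by rewrite -ler0c (le_trans _ u).
  by rewrite !lerXn2r ?nnegrE ?normr_ge0 ?ler0c.
- move=> x; rewrite mulmxA -mulmxA.
  have -> : v ^t* *m x = (x ^t* *m v) ^t* by rewrite trmx_mul map_mxM trmxCK.
  by rewrite rank_one_coef -sqr_normc exprn_ge0.
Qed.

Lemma mixture_convhull (R : realType) (n : nat) (Y : 'M[R[i]]_n)
    (S : set 'M[R[i]]_n) (P : set 'cV[R]_n) X :
  (forall Z, S Z -> P (Re_diag (Z *m Y))) -> mixture S X ->
  convhull P (Re_diag (X *m Y)).
Proof.
move=> SP mX D [D_convex PD].
elim: mX => {X} [X /SP/PD//|t X X' /andP[t0 t1] _ DX _ DX'].
rewrite Re_diag_lin; apply/set_mem.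
exact: (D_convex _ _ (Itv01 t0 t1) (mem_set DX) (mem_set DX')).
Qed.

Theorem theorem6 (R : realType) (n : nat) (N : network R n)
    (Vmin Vmax : 'I_n -> R) :
  (forall i, 0 <= Vmin i <= Vmax i) ->
  one_connected_cycles_trees N ->
  convhull (injection_region (bus_admittance N) Vmin Vmax)
  = relaxed_injection_region (bus_admittance N) Vmin Vmax.
Proof.
move=> V0 N_cat; apply/seteqP; split.
  apply: smallest_sub; first exact: relaxed_injection_region_convex.
  by apply: injection_region_sub_relaxed => i; have /andP[] := V0 i.
move=> _ [W [W_herm -> Wb W_psd]].
have [X mX XL] := tight_network N_cat W_herm W_psd.
have [XD _] := mixture_coef mX.
rewrite -(Re_diag_bus XD XL); apply: mixture_convhull mX => _ [v -> vW].
exists v; split=> // i; have /andP[Vmin0 Vminmax] := V0 i.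
have := Wb i; rewrite -vW -sqr_normc !rmorphXn/=.
by rewrite !ler_pXn2r// ?nnegrE ?ler0c// (le_trans Vmin0).
Qed.
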